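(* Let $q$ be a prime power and let $n=(q-3)q^0+(q-3)q^1+3q^2$. Then $$g_{n,q}=-3S_2S_1^{q-3}+9S_2^2S_1^{q-4}-6S_2^3S_1^{q-5}.$$
   Context: For a prime power $q$ (a power of the prime $p$) and an integer $n\ge 0$, $g_{n,q}\in\mathbb{F}_p[X]$ denotes the unique polynomial satisfying $\sum_{a\in\mathbb{F}_q}(X+a)^n=g_{n,q}(X^q-X)$. Here $S_1=X$ and $S_2=X+X^q$.
   Formalization: The formal statement assumes q ≥ 3; for q = 2 the exponents of S_1 are negative and the identity fails (n = 9: g = X^4+X^2+X+1, while the right side would be X^2+X). *)

(* Defs.v *)
From HB Require Import structures.
From mathcomp Require Import all_boot all_order all_fingroup all_algebra all_field.

Set Implicit Arguments.
Unset Strict Implicit.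
Unset Printing Implicit Defensive.

Import GRing.Theory.
Local Open Scope ring_scope.

(* The canonical embedding 'F_p -> F.  It is a ring morphism (Fp_embD and      *)
(* Fp_embM below) only when F has characteristic p.                           *)
Definition Fp_emb (F : fieldType) (p : nat) (a : 'F_p) : F := (a : nat)%:R.

Arguments Fp_emb F {p} a.

Definition is_gnq (F : finFieldType) (p n : nat) (g : {poly 'F_p}) : bool :=
  \sum_(a : F) ('X + a%:P) ^+ n == map_poly (Fp_emb F) g \Po ('X^#|F| - 'X).

Section FpEmb.

Variables (F : fieldType) (p : nat) (chF : p \in [pchar F]).

Lemma Fp_emb_nat (m : nat) : Fp_emb F (m%:R : 'F_p) = m%:R.
Proof.
have pr_p := GRing.pcharf_prime chF.
by rewrite /Fp_emb val_Fp_nat // (GRing.natr_mod_pchar chF).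
Qed.

Lemma Fp_embD (a b : 'F_p) : Fp_emb F (a + b) = Fp_emb F a + Fp_emb F b.
Proof. by rewrite -(natr_Zp a) -(natr_Zp b) -natrD !Fp_emb_nat natrD. Qed.

Lemma Fp_embM (a b : 'F_p) : Fp_emb F (a * b) = Fp_emb F a * Fp_emb F b.
Proof. by rewrite -(natr_Zp a) -(natr_Zp b) -natrM !Fp_emb_nat natrM. Qed.

Lemma Fp_emb1 : Fp_emb F (1 : 'F_p) = 1.
Proof. exact: (Fp_emb_nat 1). Qed.

Lemma Fp_emb_rmorphism :
  exists e : {rmorphism 'F_p -> F}, e =1 Fp_emb F (p := p).
Proof.
have e0 : Fp_emb F (0 : 'F_p) = 0 by exact: (Fp_emb_nat 0).
pose eN := GRing.isNmodMorphism.Build _ _ (Fp_emb F (p := p)) (conj e0 Fp_embD).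
pose eM := GRing.isMonoidMorphism.Build _ _ (Fp_emb F (p := p))
  (conj Fp_emb1 Fp_embM).
pose E : {rmorphism 'F_p -> F} :=
  HB.pack (Fp_emb F (p := p)) eN eM.
by exists E.
Qed.

Lemma Fp_emb_Frobenius (x : F) : x ^+ p = x -> exists a : 'F_p, x = Fp_emb F a.
Proof.
move=> xp; have [e eE] := Fp_emb_rmorphism.
have := finField_genPoly 'F_p; rewrite card_Fp ?(GRing.pcharf_prime chF) //.
move=> /(congr1 (map_poly e)).
rewrite rmorphB rmorph_prod /= map_polyXn map_polyX => /(congr1 (horner^~ x)).
rewrite !hornerE xp subrr horner_prod => /esym/eqP.
rewrite prodf_seq_eq0 => /hasP[a _ /=].
rewrite rmorphB /= map_polyX map_polyC /= hornerXsubC subr_eq0 eE => /eqP.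
by exists a.
Qed.

End FpEmb.

Section Gnq.

Variables (F : finFieldType) (p : nat) (chF : p \in [pchar F]) (n : nat).

Let L : {poly F} := 'X^#|F| - 'X.

Let size_L : (1 < size L)%N.
Proof.
have q_gt1 := finNzRing_gt1 F.
by rewrite /L size_polyDl size_polyXn ?size_polyN ?size_polyX // ltnS ltnW.
Qed.

Let comp_L_inj : injective (fun g : {poly F} => g \Po L).
Proof.
move=> g h /eqP; rewrite -subr_eq0 -rmorphB /= comp_poly_eq0 //.
by rewrite subr_eq0 => /eqP.
Qed.

Let L_shift (b : F) : L \Po ('X + b%:P) = L.
Proof.
rewrite /L finField_genPoly rmorph_prod /= (reindex_inj (addIr b)) /=.
apply: eq_bigr => a _.
by rewrite rmorphB /= comp_polyX comp_polyC polyCD opprD addrACA subrr addr0.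
Qed.

Let shift_comp_L (f : {poly F}) :
  (forall b : F, f \Po ('X + b%:P) = f) -> exists g, f = g \Po L.
Proof.
have L_neq0 : L != 0 by rewrite -size_poly_gt0 ltnW.
have [k] := ubnP (size f); elim: k => // k IHk in f *; rewrite ltnS => szf fI.
pose c := f.[0].
have [f0|f_neqc] := eqVneq (f - c%:P) 0.
  by exists c%:P; rewrite comp_polyC; apply/eqP; rewrite -subr_eq0 f0.
have dvdf : L %| f - c%:P.
  rewrite /L finField_genPoly -big_enum.
  rewrite uniq_roots_dvdp ?uniq_rootsE ?enum_uniq //.
  apply/allP => a _; rewrite /root !hornerE -{1}(fI (- a)) horner_comp.
  by rewrite !hornerE /= subrr subrr.
move: dvdf => /dvdpP[h fE].
have h_neq0 : h != 0 by apply: contraNneq f_neqc => h0; rewrite fE h0 mul0r.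
have hI b : h \Po ('X + b%:P) = h.
  apply: (mulIf L_neq0); rewrite -fE -{1}(L_shift b) -rmorphM /= -fE.
  by rewrite rmorphB /= comp_polyC fI.
have szh : (size h < k)%N.
  apply: leq_trans szf.
  have szfc : (1 < size (f - c%:P)%R)%N.
    have : (0 < size h)%N by rewrite size_poly_gt0.
    rewrite fE size_mul //; move: size_L.
    by case: (size L) (size h) => [|[|l]] // [|m] // _ _; rewrite !addSn !addnS.
  have -> : size f = size (f - c%:P).
    rewrite -[LHS](congr1 (size \o @polyseq F) (subrK c%:P f)) /= size_polyDl //.
    by rewrite (leq_ltn_trans _ szfc) // size_polyC leq_b1.
  rewrite fE size_mul //; move: size_L.
  by case: (size L) => [|[|l]] // _; rewrite addnS addnS /= ltnS leq_addr.
have [g hE] := IHk h szh hI.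
exists (g * 'X + c%:P).
by rewrite rmorphD rmorphM /= comp_polyX comp_polyC -hE -fE subrK.
Qed.

Lemma gnq_exists : exists g : {poly 'F_p}, is_gnq F n g.
Proof.
pose f : {poly F} := \sum_(a : F) ('X + a%:P) ^+ n.
have fI b : f \Po ('X + b%:P) = f.
  rewrite /f rmorph_sum /= [RHS](reindex_inj (addrI b)) /=.
  apply: eq_bigr => a _.
  by rewrite rmorphXn rmorphD /= comp_polyX comp_polyC polyCD addrA.
have [g fE] := shift_comp_L fI.
pose phi : {rmorphism F -> F} := pFrobenius_aut chF.
have gI : map_poly phi g = g.
  apply: comp_L_inj => /=.
  have {1}-> : L = map_poly phi L by rewrite rmorphB /= map_polyXn map_polyX.
  rewrite -map_comp_poly -fE /f rmorph_sum /=.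
  rewrite [RHS](reindex_inj (fmorph_inj phi)) /=; apply: eq_bigr => a _.
  by rewrite rmorphXn rmorphD /= map_polyX map_polyC.
have gK i : {a : 'F_p | Fp_emb F a == g`_i}.
  apply: sigW; have /(Fp_emb_Frobenius chF)[a ->] : g`_i ^+ p = g`_i.
    by rewrite -[in RHS]gI coef_map.
  by exists a.
exists (\poly_(i < size g) sval (gK i)).
rewrite /is_gnq -/f fE -/L; apply/eqP; congr (_ \Po _).
apply/polyP => i; have e0 : Fp_emb F (0 : 'F_p) = 0 by [].
rewrite coef_map_id0 // coef_poly; case: ltnP => [_|sz_i].
  by apply/esym/eqP/(svalP (gK i)).
by rewrite e0 nth_default.
Qed.

Lemma gnq_unique (g h : {poly 'F_p}) : is_gnq F n g -> is_gnq F n h -> g = h.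
Proof.
rewrite /is_gnq => /eqP-> /eqP/comp_L_inj.
have [e eE] := Fp_emb_rmorphism chF.
rewrite -!(eq_map_poly eE); exact: map_poly_inj.
Qed.

(* g_(n,q) for q = #|F|; the solution is unique by gnq_unique.                *)
Definition gnq : {poly 'F_p} := xchoose gnq_exists.

Lemma gnqP :
  \sum_(a : F) ('X + a%:P) ^+ n = map_poly (Fp_emb F) gnq \Po ('X^#|F| - 'X).
Proof. exact/eqP/(xchooseP gnq_exists). Qed.

End Gnq.

(* Powers S1 ^+ (q - k) use the truncated subtraction of nat.  In the formula *)
(* -3 S2 S1^(q-3) + 9 S2^2 S1^(q-4) - 6 S2^3 S1^(q-5) it only takes effect    *)
(* for q = 3 and q = 4, on terms whose coefficient is 0 in 'F_p.              *)
Definition S1 (R : nzRingType) : {poly R} := 'X.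
Definition S2 (R : nzRingType) (q : nat) : {poly R} := 'X + 'X^q.

(* Main.v *)
(* Put L = X^q - X and T = L + L^q.  For a in F_q and y = X + a we have
   y^q = y + L and y^(q^2) = y + T, so y^n = P(y) where
   P(Y) = Y^(q-3) (Y + L)^(q-3) (Y + T)^3 does not depend on a.  As P has degree
   2q-3 < 2(q-1) in Y, only its term in Y^(q-1) survives summation over a, and
   that term contributes minus the coefficient of Y^2 in
   (Y + L)^(q-3) (Y + T)^3. *)
Require Import Defs.
From mathcomp Require Import all_boot all_order all_fingroup all_algebra all_field.
From mathcomp Require Import ring zify.

Set Implicit Arguments.
Unset Strict Implicit.
Unset Printing Implicit Defensive.

Import GRing.Theory.
Local Open Scope ring_scope.

Section FiniteField.

Variables (F : finFieldType) (q : nat) (cardF : #|F| = q).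

Let q_gt1 : (1 < q)%N.
Proof. by rewrite -cardF finNzRing_gt1. Qed.

Let expr_q (a : F) : a ^+ q = a.
Proof. by rewrite -cardF expf_card. Qed.

Lemma pchar_nat_card : [pchar F].-nat q.
Proof.
have [p pr_p chF] := finPcharP F.
rewrite -cardF (eq_pnat _ (GRing.pcharf_eq chF)) (card_pprimeChar chF).
by rewrite pnatX pnat_id ?orbT.
Qed.

Lemma exprDn_card (x y : {poly F}) : (x + y) ^+ q = x ^+ q + y ^+ q.
Proof.
by rewrite exprDn_pchar // (eq_pnat _ (pchar_poly F)) pchar_nat_card.
Qed.

(* Translating the summation variable in [\sum_a a] by [1] adds [q%:R]. *)
Lemma natr_card : q%:R = 0 :> F.
Proof.
have : \sum_(a : F) a = \sum_(a : F) (a + 1) := reindex_inj (addIr 1).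
by rewrite big_split /= sumr_const cardF -[LHS]addr0 => /addrI <-.
Qed.

(** Compare the coefficients of ['X^i] on both sides of (1 + X)^q = 1 + X^q. *)
Lemma natr_bin_card i : (0 < i < q)%N -> 'C(q, i)%:R = 0 :> F.
Proof.
case/andP=> i_gt0 lt_i; have := congr1 (coefp i) (exprDn_card 1 'X).
rewrite /= exprDn coefD coef_sum expr1n coef1 coefXn eqn0Ngt i_gt0 /=.
rewrite (ltn_eqF lt_i) addr0 => sum0; rewrite -[RHS]sum0.
rewrite (bigD1 (Ordinal (ltnW lt_i : i < q.+1)%N)) //= big1 => [|k ne_k].
  by rewrite expr1n mul1r addr0 coefMn coefXn eqxx.
by rewrite expr1n mul1r coefMn coefXn eq_sym [_ == _]negbTE ?mul0rn.
Qed.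

Lemma sum_expr_finField i :
  (i < q)%N -> \sum_(a : F) a ^+ i = - (i == q.-1)%:R.
Proof.
move=> lt_i; have [->|i_gt0] := posnP i.
  have -> : (0 == q.-1)%N = false by lia.
  rewrite oppr0.
  by under eq_bigr do rewrite expr0; rewrite sumr_const cardF natr_card.
case: eqVneq => [i_max|ne_i].
  transitivity (\sum_(a : F) (1 - (a == 0)%:R) : F).
    apply: eq_bigr => a _; have [->|nz_a] := eqVneq a 0.
      by rewrite expr0n eqn0Ngt i_gt0 subrr.
    rewrite subr0; apply: (mulfI nz_a).
    by rewrite -exprS i_max prednK ?expr_q ?mulr1 // ltnW.
  rewrite sumrB sumr_const cardF natr_card sub0r; congr (- _).
  by rewrite (bigD1 0) //= eqxx big1 ?addr0 // => a /negbTE->.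
(* Otherwise all q - 1 nonzero elements would be roots of X^i - 1, whose degree i is positive and
   below q - 1. *)
have [b nz_b bi_neq1] : exists2 b : F, b != 0 & b ^+ i != 1.
  apply/exists_inP; apply: contraLR (leqnn q); rewrite negb_exists_in.
  move/forall_inP => all1; rewrite -ltnNge.
  have nz_P : 'X^i - 1 != 0 :> {poly F}.
    by rewrite -size_poly_eq0 size_XnsubC.
  have card_nz : size (enum (predC1 (0 : F))) = q.-1.
    by rewrite -cardE cardC1 cardF.
  have := @max_poly_roots F _ (enum (predC1 (0 : F))) nz_P _ (enum_uniq _).
  rewrite size_XnsubC // card_nz => lt_q.
  suff /lt_q : all (root ('X^i - 1)) (enum (predC1 (0 : F))) by lia.
  apply/allP=> a; rewrite mem_enum => /all1; rewrite negbK => /eqP ai1.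
  by rewrite rootE !hornerE ai1 subrr.
(* Reindexing by a |-> b * a multiplies the sum by b^i != 1. *)
rewrite oppr0; apply/eqP.
suff /eqP : (b ^+ i - 1) * (\sum_(a : F) a ^+ i) = 0.
  by rewrite mulf_eq0 subr_eq0 (negbTE bi_neq1).
rewrite mulrBl mul1r [X in _ - X](reindex_inj (mulfI nz_b)) mulr_sumr.
by under [X in _ - X]eq_bigr do rewrite exprMn; rewrite subrr.
Qed.

(** The bound is sharp: at i = 2(q - 1) the reduction used for i >= q would leave a term (X +
    a)^(q-1), whose sum is -1. *)
Lemma sum_expr_shift i : (i < q.-1.*2)%N ->
  \sum_(a : F) ('X + a%:P) ^+ i = - (i == q.-1)%:R :> {poly F}.
Proof.
have low j : (j < q)%N ->
    \sum_(a : F) ('X + a%:P) ^+ j = - (j == q.-1)%:R :> {poly F}.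
  move=> lt_j.
  transitivity (\sum_(k < j.+1)
      'X^(j - k) * (\sum_(a : F) a ^+ k)%:P *+ 'C(j, k) : {poly F}).
    under eq_bigr do rewrite exprDn.
    rewrite exchange_big /=; apply: eq_bigr => k _.
    rewrite rmorph_sum mulr_sumr -sumrMnl; apply: eq_bigr => a _.
    by rewrite rmorphXn.
  rewrite big_ord_recr /= big1 => [|k _].
    rewrite subnn expr0 mul1r binn add0r sum_expr_finField //.
    by rewrite rmorphN rmorph_nat.
  rewrite sum_expr_finField; last by have := ltn_ord k; lia.
  suff -> : (k == q.-1 :> nat) = false by rewrite oppr0 mulr0 mul0rn.
  by have := ltn_ord k; lia.
move=> lt_i; have [/low//|le_qi] := ltnP i q.
(* (X + a)^q = X^q + a lowers the exponent below q - 1. *)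
set r := (i - q)%N.
transitivity (\sum_(a : F) (('X^q - 'X) * ('X + a%:P) ^+ r
    + ('X + a%:P) ^+ r.+1) : {poly F}).
  apply: eq_bigr => a _.
  rewrite -(subnK le_qi) -/r exprD exprDn_card -rmorphXn /= expr_q exprS.
  by ring.
rewrite big_split -mulr_sumr {}/r !low /=; [|lia..].
have -> : (i - q == q.-1)%N = false by lia.
have -> : ((i - q).+1 == q.-1)%N = false by lia.
have -> : (i == q.-1)%N = false by lia.
by rewrite oppr0 mulr0 addr0.
Qed.

(** The outer variable of [P] is Y; its coefficients lie in F[X] and do not depend on a, so they
    factor out of the sum over a. *)
Lemma sum_horner_shift (P : {poly {poly F}}) : (size P <= q.-1.*2)%N ->
  \sum_(a : F) P.['X + a%:P] = - P`_q.-1.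
Proof.
move=> szP.
under eq_bigr do rewrite (horner_coef_wide _ szP).
rewrite exchange_big /=.
under eq_bigr do rewrite -mulr_sumr sum_expr_shift //.
have lt_q : (q.-1 < q.-1.*2)%N by lia.
rewrite (bigD1 (Ordinal lt_q)) //= eqxx mulrN1 big1 ?addr0 // => k ne_k.
by rewrite [_ == _]negbTE ?oppr0 ?mulr0.
Qed.

End FiniteField.

Lemma size_mul_leqS (R : nzRingType) (u v : {poly R}) i j :
  (size u <= i.+1)%N -> (size v <= j.+1)%N -> (size (u * v)%R <= (i + j).+1)%N.
Proof. by move=> szu szv; have := size_polyMleq u v; lia. Qed.

Lemma size_XaddC_exp_leq (R : nzRingType) (c : R) m :
  (size (('X + c%:P) ^+ m) <= m.+1)%N.
Proof.
by apply: leq_trans (size_poly_exp_leq _ _) _; rewrite size_XaddC mul1n.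
Qed.

(** Binomial theorem, valid also for i > m: there [m - i] is truncated to 0, but the binomial
    coefficient vanishes. *)
Lemma coef_XaddC_exp (R : comNzRingType) (c : R) m i :
  (('X + c%:P) ^+ m)`_i = c ^+ (m - i) * 'C(m, i)%:R.
Proof.
rewrite mulr_natr addrC exprDn coef_sum; have [lt_mi|le_im] := ltnP m i.
  rewrite bin_small // mulr0n big1 // => k _.
  rewrite -rmorphXn coefMn coefCM coefXn [_ == _]negbTE ?mulr0 ?mul0rn //.
  by have := ltn_ord k; lia.
rewrite (bigD1 (Ordinal (le_im : i < m.+1)%N)) //= big1 => [|k ne_k].
  by rewrite addr0 -rmorphXn coefMn coefCM coefXn eqxx mulr1.
by rewrite -rmorphXn coefMn coefCM coefXn eq_sym [_ == _]negbTE ?mulr0 ?mul0rn.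
Qed.

(** The three terms take degree 0, 1 and 2 in Y from the first factor. For m < 2 each truncated
    exponent comes with a zero coefficient. *)
Lemma coef2_XaddC_exp_cube (R : comNzRingType) (L T : R) m :
  (('X + L%:P) ^+ m * ('X + T%:P) ^+ 3)`_2
  = 3 * T * L ^+ m + 3 * m%:R * T ^+ 2 * L ^+ (m - 1)
    + 'C(m, 2)%:R * T ^+ 3 * L ^+ (m - 2).
Proof.
rewrite coefM 2!big_ord_recr big_ord1 /= !coef_XaddC_exp.
rewrite !subSS !subn0 !bin0 !bin1 (_ : 'C(3, 2) = 3)%N //.
by ring.
Qed.

(** Formally this is (-3)(-4)/2, but 2 is not invertible in characteristic 2. Instead, 'C(m + 3, 2)
    = 'C(m, 2) + 3m + 3 is used at m = q - 3, where 'C(q, 2) and q both vanish in [F]. *)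
Lemma natr_bin2_card_sub3 (F : finFieldType) q :
  #|F| = q -> (3 <= q)%N -> 'C(q - 3, 2)%:R = 6 :> F.
Proof.
move=> cardF q_ge3.
have := @natr_bin_card F q cardF 2 q_ge3; have := natr_card cardF.
case: q q_ge3 {cardF} => [|[|[|m]]] // _; rewrite !subSS subn0.
have -> : 'C(m.+3, 2) = ('C(m, 2) + 3 * m + 3)%N.
  by rewrite !binS !bin1 !bin0; lia.
rewrite -[m.+3]addn3 natrD (natrD _ _ 3) (natrD _ _ (3 * m)) natrM.
move=> q0 c0; apply/eqP; rewrite -subr_eq0.
have -> : 'C(m, 2)%:R - 6 = 'C(m, 2)%:R + 3 * m%:R + 3 - 3 * (m%:R + 3) :> F.
  by ring.
by rewrite c0 q0 mulr0 subr0.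
Qed.

Theorem lemma2p8 (F : finFieldType) (p q n : nat) (chF : p \in [pchar F])
    (cardF : #|F| = q) (q_ge3 : (3 <= q)%N)
    (def_n : n = ((q - 3) * q ^ 0 + (q - 3) * q ^ 1 + 3 * q ^ 2)%N) :
  gnq chF n =
    - 3 * S2 'F_p q * S1 'F_p ^+ (q - 3)
    + 9 * S2 'F_p q ^+ 2 * S1 'F_p ^+ (q - 4)
    - 6 * S2 'F_p q ^+ 3 * S1 'F_p ^+ (q - 5).
Proof.
(* By uniqueness, it suffices that the right-hand side satisfies the defining identity. *)
apply: (gnq_unique chF (n := n)); first exact: (xchooseP (gnq_exists chF n)).
have [e eE] := Fp_emb_rmorphism chF.
rewrite /is_gnq -(eq_map_poly eE) cardF.
pose L : {poly F} := 'X^q - 'X; pose T : {poly F} := L + L ^+ q.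
(* Substituting L is packaged as a ring morphism, so that the formula can be evaluated from [S1] and
   [S2], which go to L and T. *)
have [phi phiE] : exists phi : {rmorphism {poly 'F_p} -> {poly F}},
    forall g, phi g = map_poly e g \Po L.
  by exists (comp_poly L \o map_poly e).
have phi_S1 : phi (S1 'F_p) = L by rewrite phiE map_polyX comp_polyX.
have phi_S2 : phi (S2 'F_p q) = T by rewrite rmorphD rmorphXn phi_S1.
rewrite -phiE rmorphB rmorphD !rmorphM rmorphN !rmorph_nat !rmorphXn /=.
rewrite phi_S1 phi_S2.
pose P : {poly {poly F}} :=
  'X^(q - 3) * (('X + L%:P) ^+ (q - 3) * ('X + T%:P) ^+ 3).
have powE (a : F) : ('X + a%:P) ^+ n = P.['X + a%:P].
  have frob x : (x + a%:P) ^+ q = x ^+ q + a%:P.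
    by rewrite (exprDn_card cardF) -rmorphXn -cardF expf_card.
  have yqE : 'X + a%:P + L = ('X + a%:P) ^+ q by rewrite frob /L; ring.
  have yqqE : 'X + a%:P + T = ('X + a%:P) ^+ (q * q).
    by rewrite exprM -yqE [in RHS]addrAC frob (exprDn_card cardF) /T /L; ring.
  rewrite /P hornerM hornerM !horner_exp !hornerD !hornerX !hornerC.
  by rewrite yqE yqqE -!exprM -!exprD def_n; congr (_ ^+ _); lia.
under eq_bigr do rewrite powE.
rewrite (sum_horner_shift cardF); last first.
  (* The degree is at most 2q - 3, so the size just meets the bound 2(q - 1). *)
  have szP : (size P <= (q - 3 + (q - 3 + 3)).+1)%N.
    by do !apply: size_mul_leqS; rewrite ?size_polyXn ?size_XaddC_exp_leq.
  by apply: leq_trans szP _; lia.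
rewrite coefXnM; case: ifP => [|_]; first by lia.
have -> : (q.-1 - (q - 3) = 2)%N by lia.
(* Merging the nested subtractions gives the exponents q - 4 and q - 5 even when truncated, so q = 3
   and q = 4 need no separate case. *)
rewrite coef2_XaddC_exp_cube -!subnDA.
have q0 : q%:R = 0 :> {poly F} by rewrite -polyC_natr (natr_card cardF).
have -> : (q - 3)%:R = - 3 :> {poly F} by rewrite natrB // q0 sub0r.
have -> : 'C(q - 3, 2)%:R = 6 :> {poly F}.
  by rewrite -polyC_natr (natr_bin2_card_sub3 cardF) // polyC_natr.
by apply/eqP; ring.
Qed.
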